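(* Let $G$ be a connected graph and let $k$, $\lambda$, $m$ be positive integers with $2\le m\le\min\{k,\lambda\}+1$. Then either $$t_{k+1}\ge \sigma_m+\lambda(k-m+1)+1$$ or $$t_k\ge t_{k+1}-\lambda+1.$$
   Context: All graphs are finite, undirected, without loops or multiple edges. The order of a (sub)graph is its number of vertices. A leaf of a tree is a vertex of degree one in the tree. For a positive integer $k$, a $k$-ended tree is a tree with at most $k$ leaves. By convention, a 1-ended tree is interpreted as a cycle, where a single vertex and a single edge ($K_2$) are regarded as cycles of orders 1 and 2, respectively. For a graph $G$, $t_k$ denotes the order of a largest $k$-ended tree that is a (not necessarily induced) subgraph of $G$; in particular $t_1$ is the order of a longest cycle of $G$ (with vertices and edges counted as cycles of orders 1 and 2), and $t_2$ is the order of a longest path. Let $\alpha$ be the independence number of $G$. If $\alpha\ge m$, then $\sigma_m$ is the minimum, over all independent sets of $m$ vertices of $G$, of the sum of the degrees in $G$ of the vertices of the set; if $\alpha<m$, then $\sigma_m=+\infty$. *)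

(* Defs.v *)
From HB Require Import structures.
From mathcomp Require Import all_boot all_order all_algebra.
From mathcomp Require Import boolp constructive_ereal.

Set Implicit Arguments.
Unset Strict Implicit.
Unset Printing Implicit Defensive.

Import Order.TTheory GRing.Theory Num.Theory.

Record sgraph := SGraph {
  vertex :> finType;
  adj : rel vertex;
  adj_sym : symmetric adj;
  adj_irr : irreflexive adj
}.

Section Graph.
Variable G : sgraph.

Definition connected : Prop :=
  (0 < #|G|)%N /\ forall x y : G, connect (@adj G) x y.

Definition deg (x : G) : nat := #|[set y : G | adj x y]|.

Definition independent (S : {set G}) : bool :=
  [forall x in S, forall y in S, ~~ adj x y].

Definition alpha : nat := \max_(S : {set G} | independent S) #|S|.

(* The value lives in the extended integers so that it can be +oo. *)
Definition sigma (m : nat) : \bar int :=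
  if (m <= alpha)%N then
    \big[Order.min/+oo%E]_(S : {set G} | independent S && (#|S| == m))
      ((\sum_(x in S) deg x)%N%:Z)%:E
  else +oo%E.

(* A vertex set together with an edge set, an edge {x, y} being stored as the
   two pairs (x, y) and (y, x). *)
Definition pregraph : Type := ({set G} * {set G * G})%type.

Implicit Type H : pregraph.

Definition verts H : {set G} := H.1.
Definition padj H : rel G := fun x y => (x, y) \in H.2.

Definition is_subgraph H : Prop :=
  forall x y : G, padj H x y ->
    [/\ x \in verts H, y \in verts H, adj x y & padj H y x].

Definition is_connected H : Prop :=
  verts H != set0 /\
  {in verts H &, forall x y, connect (padj H) x y}.

(* On sequences of size 2, [ucycle] merely says that the two vertices are
   adjacent; genuine closed walks without repetition have size at least 3. *)
Definition is_acyclic H : Prop :=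
  forall c : seq G, ucycle (padj H) c -> (size c < 3)%N.

Definition is_tree H : Prop := is_connected H /\ is_acyclic H.

Definition pdeg H (x : G) : nat := #|[set y : G | padj H x y]|.

Definition leaves H : {set G} := [set x in verts H | pdeg H x == 1%N].

(* The vertices can be arranged cyclically so that the edges join exactly the
   consecutive ones.  A single vertex has no edges and is treated apart; for
   two vertices the condition describes K_2. *)
Definition is_cycle H : Prop :=
  #|verts H| = 1%N \/
  exists c : seq G,
    [/\ (1 < size c)%N, uniq c, verts H = [set x in c] &
        forall x y : G, padj H x y =
          [&& x \in c, y \in c & (y == next c x) || (x == next c y)]].

Definition ended_tree (k : nat) H : Prop :=
  if k == 1%N then is_cycle H else is_tree H /\ (#|leaves H| <= k)%N.

(* For G nonempty and k > 0 the range of the maximum is nonempty, as it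
   contains the one-vertex subgraphs. *)
Definition t_ended (k : nat) : nat :=
  \max_(H : pregraph | `[< is_subgraph H /\ ended_tree k H >]) #|verts H|.

End Graph.

(* Main.v *)
Require Import Defs.
From mathcomp Require Import all_boot all_order all_algebra.
From mathcomp Require Import boolp constructive_ereal.
From mathcomp Require Import zify.

(** Let T be a largest tree of G with at most k + 1 leaves, N its order, and
suppose that t_k + lambda <= N.  Trees with at most k leaves, and also trees
with at most k + 1 leaves two of which are adjacent in G
([adjacent_leaves]), have order at most t_k.  So lambda vertices are lost
whenever T is turned into a tree of either kind.  In particular T has exactly
k + 1 leaves, they are pairwise nonadjacent, and their neighbours all lie in T.

This scarcity makes T rigid near its leaves and near the neighbours of its
leaves.  Walk into T from a leaf y: the first lambda vertices, y included, are
adjacent to no other leaf, and those after y have degree 2; otherwise, deleting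
the vertices before the first bad one would give a tree that is too large
([leaf_window]).  Now let h be a leaf, v a neighbour of h in G, and w the vertex
that follows v on the path of T from v to h.  Replacing the edge vw by vh gives
another optimal tree, in which w is a leaf instead of h.  The same fact there
says that the lambda vertices after v on the path from v to h, as long as they
precede h, have degree 2 in T and no adjacent leaf other than h ([chord_window]).

Fix a set X of m leaves.  The degree sum of X counts the pairs (h, v) with h in
X and v adjacent to h.  To such a pair corresponds the edge of T by which the
path from v to h leaves v, and several h may share it.  When d members of X
adjacent to v share it, they are ranked 0, ..., d - 1, and the member of rank a
receives the edge that lies a steps further along its path.  Since
d <= m <= lambda + 1, these edges lie in the windows just described, and there
the edges received by distinct pairs cannot coincide:
- if both paths traverse the edge in the same direction, then one path starts
  inside the window of the other, where no other leaf has a neighbour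
  ([charges_same]);
- if they traverse it in opposite directions, then the sets of leaves sharing
  the two starting edges are disjoint, so the ranks a and b satisfy
  a + b + 1 < m, and again one path starts inside the window of the other
  ([charges_opposite]).
In addition every leaf outside X reserves the first lambda edges on its path
into T, and the edges received by pairs avoid them.  As T has N - 1 edges, the
degree sum of X plus lambda (k + 1 - m) is at most N - 1 ([sum_deg_le]). *)

Set Implicit Arguments.
Unset Strict Implicit.
Unset Printing Implicit Defensive.

(** * Trees and bridges *)
Section Trees.
Variable G : sgraph.
Implicit Types (H : pregraph G) (u v w x y z p q : G) (s : seq G).

Definition same_edge p q u v := (p == u) && (q == v) || (p == v) && (q == u).

Definition del_edge H u v : pregraph G :=
  (verts H, H.2 :\: [set (u, v); (v, u)]).

Definition add_edge H x y : pregraph G :=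
  (x |: (y |: verts H), H.2 :|: [set (x, y); (y, x)]).

Definition del_vertex H y : pregraph G :=
  (verts H :\ y, [set e in H.2 | (e.1 != y) && (e.2 != y)]).

(** Acyclicity in a form stable under exchanging edges: a cycle is never
mentioned, only the connectedness of the tree without one of its edges. *)
Definition bridged H :=
  forall u v, padj H u v -> ~~ connect (padj (del_edge H u v)) u v.

Record stree H : Prop := STree {
  stree_subgraph : is_subgraph H;
  stree_conn : is_connected H;
  stree_bridged : bridged H }.

Lemma same_edge_flip p q u v : same_edge p q u v = same_edge q p u v.
Proof. by rewrite /same_edge orbC andbC [X in _ || X]andbC. Qed.

Lemma padj_del_edge H u v p q :
  padj (del_edge H u v) p q = padj H p q && ~~ same_edge p q u v.
Proof. by rewrite /padj /same_edge !inE !xpair_eqE andbC. Qed.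

Lemma padj_add_edge H x y p q :
  padj (add_edge H x y) p q = padj H p q || same_edge p q x y.
Proof. by rewrite /padj /same_edge !inE !xpair_eqE. Qed.

Lemma padj_del_vertex H y p q :
  padj (del_vertex H y) p q = [&& padj H p q, p != y & q != y].
Proof. by rewrite /padj !inE. Qed.

Lemma padj_sym H : is_subgraph H -> symmetric (padj H).
Proof. by move=> sH p q; apply/idP/idP => /sH[]. Qed.

Lemma padj_neq H p q : is_subgraph H -> padj H p q -> p != q.
Proof.
by move=> sH /sH[_ _ + _]; apply: contraTneq => ->; rewrite adj_irr.
Qed.

Lemma connect_padj_sym H : is_subgraph H -> connect_sym (padj H).
Proof. by move=> sH; apply/sym_connect_sym/padj_sym. Qed.

Lemma subgraph_del_edge H u v : is_subgraph H -> is_subgraph (del_edge H u v).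
Proof.
move=> sH p q; rewrite !padj_del_edge => /andP[/sH[pH qH apq ->]].
by rewrite same_edge_flip => ->.
Qed.

Lemma subgraph_add_edge H x y :
  is_subgraph H -> adj x y -> is_subgraph (add_edge H x y).
Proof.
move=> sH axy p q; rewrite !padj_add_edge => /orP[/sH[pH qH apq ->]|spq].
  by split; rewrite // !inE ?pH ?qH !orbT.
rewrite same_edge_flip spq orbT.
by case/orP: spq => /andP[/eqP-> /eqP->]; rewrite !inE !eqxx ?orbT // adj_sym.
Qed.

Lemma subgraph_del_vertex H y : is_subgraph H -> is_subgraph (del_vertex H y).
Proof.
move=> sH p q; rewrite !padj_del_vertex => /and3P[/sH[pH qH apq ->] py qy].
by rewrite !inE py qy.
Qed.

Lemma connect_verts H p q :
  is_subgraph H -> p \in verts H -> connect (padj H) p q -> q \in verts H.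
Proof.
move=> sH pH /connectP[s ps ->]; elim: s p pH ps => //= a s IH p _.
by case/andP=> /sH[_ aH _ _]; exact: IH.
Qed.

Lemma path_avoid_edge H u v p s : path (padj H) p s -> u \notin p :: s ->
  path (padj (del_edge H u v)) p s.
Proof.
elim: s p => //= a s IH p /andP[pa ps]; rewrite !inE !negb_or.
case/and3P=> up ua us; rewrite padj_del_edge pa /= IH ?inE ?negb_or ?ua //.
by rewrite andbT /same_edge eq_sym (negPf up) [a == u]eq_sym (negPf ua) andbF.
Qed.

Lemma del_edgeC H u v : del_edge H u v = del_edge H v u.
Proof. by rewrite /del_edge setUC. Qed.

(** A path either avoids a new edge or may be assumed to use it once, in one of
its two directions. *)
Lemma connect_add_rel (e : rel G) x y p q :
  connect (fun a b => e a b || same_edge a b x y) p q ->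
  [\/ connect e p q, connect e p x /\ connect e y q |
      connect e p y /\ connect e x q].
Proof.
case/connectP=> s ps ->; elim: s p ps => [|a s IH] p /=.
  by move=> _; constructor 1; rewrite connect0.
case/andP=> /orP[pa /IH|/orP[]/andP[/eqP-> /eqP->] /IH].
- move/connect1: pa => pa [c|[c1 c2]|[c1 c2]].
  + by constructor 1; apply: connect_trans c.
  + by constructor 2; split=> //; apply: connect_trans c1.
  + by constructor 3; split=> //; apply: connect_trans c1.
- by case=> [c|[c1 c2]|[c1 c2]]; [constructor 2|constructor 2|constructor 1].
- by case=> [c|[c1 c2]|[c1 c2]]; [constructor 3|constructor 1|constructor 3].
Qed.

(** A path joining the ends of an edge and avoiding that edge closes up to a
cycle. *)
Lemma acyclic_bridged H : is_subgraph H -> is_acyclic H -> bridged H.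
Proof.
move=> sH aH u v uv; apply/negP => /connectP[s0 ps0 lst].
case/shortenP: ps0 lst => s ps us _ vE.
have subH : subrel (padj (del_edge H u v)) (padj H).
  by move=> a b; rewrite padj_del_edge => /andP[].
have uc : ucycle (padj H) (u :: s).
  rewrite /ucycle us andbT /= rcons_path (sub_path subH ps) -vE.
  by rewrite padj_sym.
have := aH _ uc; case: s ps {us uc} vE => [_ vE|a [|//]].
  by move: (padj_neq sH uv); rewrite vE eqxx.
by rewrite /= andbT padj_del_edge => + vE; rewrite vE /same_edge !eqxx andbF.
Qed.

Lemma bridged_acyclic H : is_subgraph H -> bridged H -> is_acyclic H.
Proof.
move=> sH bH [|x [|y [|z s]]] //= /andP[/= /and3P[xy yz] ps].
move=> /andP[]; set t := z :: s => xt uyt; exfalso.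
move: ps; rewrite rcons_path => /andP[ps lx].
have: connect (padj (del_edge H x y)) y (last z s).
  apply/connectP; exists t => //.
  by apply: path_avoid_edge => //=; rewrite yz.
rewrite connect_padj_sym; last exact: subgraph_del_edge.
move=> c; have /negP := bH _ _ xy; apply.
rewrite connect_padj_sym; last exact: subgraph_del_edge.
rewrite (connect_padj_sym (subgraph_del_edge sH)) in c.
apply: connect_trans c (connect1 _).
rewrite padj_del_edge lx /= /same_edge negb_or !negb_and.
have ny : last z s != y.
  by move/andP: uyt => [yt _]; apply: contraNneq yt => <-; apply: mem_last.
have nx : last z s != x.
  by apply: contraNneq xt => <-; rewrite inE mem_last orbT.
by rewrite nx ny.
Qed.

Lemma tree_stree H : is_subgraph H -> is_tree H -> stree H.
Proof. by move=> sH [cH aH]; split=> //; apply: acyclic_bridged. Qed.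

Lemma stree_tree H : stree H -> is_tree H.
Proof. by case=> sH cH bH; split=> //; apply: bridged_acyclic. Qed.

Lemma bridged_subrel H H' :
  subrel (padj H') (padj H) -> bridged H -> bridged H'.
Proof.
move=> sub bH u v /sub /bH; apply: contraNN; apply: connect_sub => a b.
rewrite padj_del_edge => /andP[/sub ab nab].
by apply: connect1; rewrite padj_del_edge ab.
Qed.

(** A path around an old edge pq that used the new edge xy would, together with
pq, connect x to y without xy. *)
Lemma bridged_add_edge H x y : is_subgraph H -> bridged H ->
  ~~ connect (padj H) x y -> bridged (add_edge H x y).
Proof.
move=> sH bH nxy p q; rewrite padj_add_edge => pq; apply/negP => c.
have csym := connect_padj_sym sH.
have [spq|nspq] := boolP (same_edge p q x y).
  have : connect (padj H) p q.
    apply: connect_sub c => a b; rewrite padj_del_edge padj_add_edge.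
    case/andP=> /orP[/connect1//|sab nab]; move: nab; rewrite -[_ _ _ p q]negbK.
    case/negP; apply/negPn; move: spq sab.
    by do 2!case/orP=> /andP[/eqP-> /eqP->]; rewrite /same_edge !eqxx ?orbT.
  by case/orP: spq => /andP[/eqP-> /eqP->]; last rewrite csym; apply/negP.
rewrite (negPf nspq) orbF in pq.
have sub1 : subrel (padj (del_edge H p q)) (padj H).
  by move=> a b; rewrite padj_del_edge => /andP[].
have cs a b : connect (padj (del_edge H p q)) a b -> connect (padj H) a b.
  by apply: connect_sub => ? ? /sub1/connect1.
have : connect (fun a b => padj (del_edge H p q) a b || same_edge a b x y) p q.
  apply: connect_sub c => a b; rewrite padj_del_edge padj_add_edge.
  case/andP=> ab nab; apply: connect1.
  by rewrite padj_del_edge nab andbT.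
case/connect_add_rel=> [c1|[/cs c1 /cs c2]|[/cs c1 /cs c2]].
- by have := bH _ _ pq; rewrite c1.
- case/negP: nxy; rewrite csym in c1.
  apply: connect_trans c1 (connect_trans (connect1 pq) _).
  by rewrite csym.
- case/negP: nxy; apply: connect_trans c2 (connect_trans (connect1 _) c1).
  by rewrite padj_sym.
Qed.

Lemma verts_exchange H u v x y : is_subgraph H -> padj H u v ->
  connect (padj (del_edge H u v)) u x -> connect (padj (del_edge H u v)) v y ->
  verts (add_edge (del_edge H u v) x y) = verts H.
Proof.
move=> sH uv cux cvy; have sD := subgraph_del_edge (u := u) (v := v) sH.
have [uH vH _ _] := sH _ _ uv.
have xH : x \in verts H by have := connect_verts sD uH cux.
have yH : y \in verts H by have := connect_verts sD vH cvy.
have yE : y |: verts H = verts H by apply/setUidPr; rewrite sub1set.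
have xE : x |: verts H = verts H by apply/setUidPr; rewrite sub1set.
by rewrite -[RHS]xE -yE.
Qed.

(** The basic surgery: cut the tree at uv and join the two pieces again along
an edge xy of the ambient graph. *)
Lemma stree_exchange H u v x y : stree H -> padj H u v -> adj x y ->
  connect (padj (del_edge H u v)) u x -> connect (padj (del_edge H u v)) v y ->
  stree (add_edge (del_edge H u v) x y).
Proof.
move=> [sH cH bH] uv axy cux cvy; have sD := subgraph_del_edge (u := u) (v := v) sH.
have sA := subgraph_add_edge sD axy.
have csD := connect_padj_sym sD; have csA := connect_padj_sym sA.
have vE := verts_exchange sH uv cux cvy.
split=> //; last first.
  apply: bridged_add_edge => //.
    by apply: bridged_subrel bH => a b; rewrite padj_del_edge => /andP[].
  apply: contra (bH _ _ uv) => cxy.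
  by apply: connect_trans cux (connect_trans cxy _); rewrite csD.
split; first by rewrite vE; case: cH.
move=> p q; rewrite vE => pH qH.
have DA : subrel (connect (padj (del_edge H u v)))
                 (connect (padj (add_edge (del_edge H u v) x y))).
  by apply: connect_sub => a b ab; apply: connect1; rewrite padj_add_edge ab.
have cuv : connect (padj (add_edge (del_edge H u v) x y)) u v.
  apply: connect_trans (DA _ _ cux) _; rewrite csA.
  apply: connect_trans (DA _ _ cvy) _; rewrite csA; apply: connect1.
  by rewrite padj_add_edge /same_edge !eqxx orbT.
case: cH => _ /(_ p q pH qH); apply: connect_sub => a b ab.
have [sab|nsab] := boolP (same_edge a b u v).
  by case/orP: sab => /andP[/eqP-> /eqP->]; last rewrite csA.
by apply: DA; apply: connect1; rewrite padj_del_edge ab.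
Qed.

(** * Degrees and leaves *)
Lemma pdeg_ge H p (A : {set G}) : {in A, forall a, padj H p a} -> #|A| <= pdeg H p.
Proof. by move=> AH; apply/subset_leq_card/subsetP=> a /AH; rewrite inE. Qed.

Lemma pdeg_gt1 H p a b : padj H p a -> padj H p b -> a != b -> 1 < pdeg H p.
Proof.
move=> pa pb ab; have <- : #|[set a; b]| = 2 by rewrite cards2 ab.
by apply: pdeg_ge => c; rewrite !inE => /orP[]/eqP->.
Qed.

Lemma pdeg_gt2 H p a b c : padj H p a -> padj H p b -> padj H p c ->
  a != b -> a != c -> b != c -> 2 < pdeg H p.
Proof.
move=> pa pb pc ab ac bc; have <- : #|c |: [set a; b]| = 3.
  by rewrite cardsU1 cards2 ab !inE negb_or ![c == _]eq_sym ac bc.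
by apply: pdeg_ge => d; rewrite !inE => /orP[|/orP[]]/eqP->.
Qed.

Lemma leaf_neighbor H p a b : pdeg H p = 1 -> padj H p a -> padj H p b -> a = b.
Proof.
by move=> p1 pa pb; apply/eqP; case: eqP (pdeg_gt1 pa pb) => // _ /(_ isT); rewrite p1.
Qed.

Lemma pdeg2_neighbor H p a b c : pdeg H p = 2 ->
  padj H p a -> padj H p b -> padj H p c -> a != b -> a != c -> b = c.
Proof.
move=> p2 pa pb pc ab ac; apply/eqP; apply: contraT.
by move/(pdeg_gt2 pa pb pc ab ac); rewrite p2.
Qed.

Lemma pdeg_del_edge H u v z : is_subgraph H -> padj H u v ->
  pdeg H z = pdeg (del_edge H u v) z + ((z == u) || (z == v)).
Proof.
move=> sH uv; have vu : padj H v u by rewrite padj_sym.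
have nuv := padj_neq sH uv.
rewrite /pdeg; have [->|zu] := eqVneq z u.
  rewrite (cardsD1 v) inE uv addnC; congr (_ + _); apply: eq_card => a.
  by rewrite !inE padj_del_edge /same_edge eqxx (negPf nuv) orbF andbC.
have [->|zv] := eqVneq z v.
  rewrite (cardsD1 u) inE vu addnC; congr (_ + _); apply: eq_card => a.
  by rewrite !inE padj_del_edge /same_edge eqxx [v == u]eq_sym (negPf nuv) andbC.
rewrite addn0; apply: eq_card => a.
by rewrite !inE padj_del_edge /same_edge (negPf zu) (negPf zv) andbT.
Qed.

Lemma pdeg_add_edge H x y z : is_subgraph H -> x != y -> ~~ padj H x y ->
  pdeg (add_edge H x y) z = pdeg H z + ((z == x) || (z == y)).
Proof.
move=> sH nxy xy; have yx : ~~ padj H y x by rewrite padj_sym.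
rewrite /pdeg; have [->|zx] := eqVneq z x.
  rewrite (cardsD1 y) inE padj_add_edge /same_edge !eqxx orbT addnC.
  congr (_ + _); apply: eq_card => a.
  rewrite !inE padj_add_edge /same_edge eqxx (negPf nxy) orbF.
  by case: eqP => [->|_]; rewrite ?(negPf xy) ?orbF.
have [->|zy] := eqVneq z y.
  rewrite (cardsD1 x) inE padj_add_edge /same_edge !eqxx !orbT addnC.
  congr (_ + _); apply: eq_card => a.
  rewrite !inE padj_add_edge /same_edge eqxx [y == x]eq_sym (negPf nxy) /=.
  by case: eqP => [->|_]; rewrite ?(negPf yx) ?orbF.
rewrite addn0; apply: eq_card => a.
by rewrite !inE padj_add_edge /same_edge (negPf zx) (negPf zy) orbF.
Qed.

(** The four endpoints may overlap (a new edge may start at an end of the old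
one), hence the symmetric form with a correction on both sides. *)
Lemma pdeg_exchange H u v x y z : stree H -> padj H u v -> x != y ->
  connect (padj (del_edge H u v)) u x -> connect (padj (del_edge H u v)) v y ->
  pdeg (add_edge (del_edge H u v) x y) z + ((z == u) || (z == v)) =
  pdeg H z + ((z == x) || (z == y)).
Proof.
move=> [sH cH bH] uv nxy cux cvy.
rewrite (pdeg_del_edge z sH uv) pdeg_add_edge //; first by rewrite addnAC.
  exact: subgraph_del_edge.
apply: contra (bH _ _ uv) => /connect1 cxy.
apply: connect_trans cux (connect_trans cxy _).
by rewrite connect_padj_sym //; apply: subgraph_del_edge.
Qed.

Lemma pdeg_del_vertex H y z : z != y ->
  pdeg H z = pdeg (del_vertex H y) z + padj H z y.
Proof.
move=> zy; rewrite /pdeg (cardsD1 y) inE addnC; congr (_ + _).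
by apply: eq_card => a; rewrite !inE padj_del_vertex zy /= andbC.
Qed.

Lemma in_leaves H x : (x \in leaves H) = (x \in verts H) && (pdeg H x == 1).
Proof. by rewrite inE. Qed.

Lemma leaf_pdeg H x : x \in leaves H -> pdeg H x = 1.
Proof. by rewrite in_leaves => /andP[_ /eqP]. Qed.

Lemma leaf_has_neighbor H x : x \in leaves H -> exists y, padj H x y.
Proof.
move/leaf_pdeg=> x1; have /card_gt0P[y] : 0 < #|[set y | padj H x y]|.
  by rewrite -/(pdeg H x) x1.
by rewrite inE; exists y.
Qed.

(** Sending the deleted leaf to its neighbour maps paths of the tree to paths
of the pruned tree, which is therefore connected. *)
Lemma stree_del_leaf H y : stree H -> y \in leaves H -> stree (del_vertex H y).
Proof.
move=> [sH cH bH] yL; have [y1 yy1] := leaf_has_neighbor yL.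
have [yH y1H _ y1y] := sH _ _ yy1; have y1n := padj_neq sH y1y.
split; [exact: subgraph_del_vertex| |].
  split; first by apply/set0Pn; exists y1; rewrite !inE y1n.
  move=> p q; rewrite !inE => /andP[py pH] /andP[qy qH].
  pose f z := if z == y then y1 else z.
  have fE z : z != y -> f z = z by rewrite /f => /negPf->.
  rewrite -(fE p) // -(fE q) //; case: cH => _ /(_ p q pH qH).
  case/connectP=> s ps ->; elim: s p ps {py pH} => //= a s IH p /andP[pa ps].
  apply: connect_trans (IH _ ps).
  have [ay|ay] := eqVneq a y.
    subst a; have -> : p = y1.
      by apply: (leaf_neighbor (leaf_pdeg yL)) => //; rewrite padj_sym.
    by rewrite fE // /f eqxx.
  have [py|py] := eqVneq p y.
    subst p; have -> := leaf_neighbor (leaf_pdeg yL) pa yy1.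
    by rewrite (fE y1) // /f eqxx.
  by rewrite !fE //; apply: connect1; rewrite padj_del_vertex pa py.
apply: bridged_subrel bH => a b; rewrite padj_del_vertex.
by case/and3P.
Qed.

Lemma stree_add_leaf H h z : stree H -> h \in verts H -> z \notin verts H ->
  adj h z -> stree (add_edge H h z).
Proof.
move=> [sH cH bH] hH zH hz; have sA := subgraph_add_edge sH hz.
have csA := connect_padj_sym sA.
split=> //; last first.
  by apply: bridged_add_edge => //; apply: contra zH; apply: connect_verts.
split; first by apply/set0Pn; exists h; rewrite !inE eqxx.
have toh p : p \in verts (add_edge H h z) -> connect (padj (add_edge H h z)) p h.
  rewrite !inE => /or3P[/eqP->|/eqP->|pH]; first exact: connect0.
    by apply: connect1; rewrite padj_add_edge /same_edge !eqxx !orbT.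
  case: cH => _ /(_ p h pH hH); apply: connect_sub => a b ab.
  by apply: connect1; rewrite padj_add_edge ab.
by move=> p q /toh cp /toh cq; apply: connect_trans cp _; rewrite csA.
Qed.

(** * Paths in a tree *)
Definition upath H x s := path (padj H) x s && uniq (x :: s).

(** If two paths with the same ends started along different edges, the first
edge of one could be bypassed through the other. *)
Lemma upath_unique H x s t : stree H -> upath H x s -> upath H x t ->
  last x s = last x t -> s = t.
Proof.
move=> [sH _ bH]; elim: s x t => [|u s IH] x [|v t] //=.
- move=> _ /andP[_ /= /andP[xt _]] xE; case/negP: xt.
  by rewrite {1}xE mem_last.
- move=> /andP[_ /= /andP[xt _]] _ xE; case/negP: xt.
  by rewrite -{1}xE mem_last.
rewrite /upath /= => /andP[/andP[xu us] /andP[xnus uus]].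
case/andP=> /andP[xv vt] /andP[xnvt uvt] lE.
have [uv|nuv] := eqVneq u v.
  by subst v; rewrite (IH u t) // /upath ?us ?vt.
have /negP[] := bH _ _ xu.
have csD := connect_padj_sym (subgraph_del_edge (u := x) (v := u) sH).
apply: (@connect_trans _ _ v).
  apply: connect1; rewrite padj_del_edge xv /same_edge eqxx /= eq_sym (negPf nuv).
  by rewrite (negPf (padj_neq sH xu)).
apply: (@connect_trans _ _ (last v t)).
  by apply/connectP; exists t => //; apply: path_avoid_edge.
rewrite csD -lE; apply/connectP; exists s => //; exact: path_avoid_edge.
Qed.

Definition tpath H x y : seq G :=
  if pselect (exists s, upath H x s && (last x s == y)) is left e
  then xchoose e else [::].

Lemma tpathP H x y : connect (padj H) x y ->
  upath H x (tpath H x y) /\ last x (tpath H x y) = y.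
Proof.
move=> /connectP[s0 ps0 ->]; case/shortenP: ps0 => s ps us _.
rewrite /tpath; case: pselect => [e|[]].
  by have /andP[? /eqP] := xchooseP e.
by exists s; rewrite /upath ps us /=.
Qed.

(** [H.2] contains both orientations of every edge.  Rooting the tree at r,
each of these pairs joins a vertex other than r to its parent, in one of the two
orders. *)
Lemma tree_darts H : stree H -> #|H.2| + 2 <= 2 * #|verts H|.
Proof.
move=> tH; have [sH [/set0Pn[r rH] cH] bH] := tH.
pose par v := head r (tpath H v r).
pose A := [set (v, par v) | v in verts H :\ r].
pose B := [set (par v, v) | v in verts H :\ r].
have sub : H.2 \subset A :|: B.
  apply/subsetP=> -[u v]; rewrite -[_ \in H.2]/(padj H u v) => uv.
  have [uH vH _ vu] := sH _ _ uv.
  have [] := tpathP (cH _ _ uH rH); set s := tpath H u r => us lus.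
  have [vs|vs] := boolP (v \in s).
    have us1 : upath H u [:: v].
      by rewrite /upath /= uv inE (padj_neq sH uv).
    have ur : u != r.
      apply: contraTneq vs => ur; case: (s) us lus => //= a s' /andP[_ /andP[us' _]] lE.
      by move: us'; rewrite {1}ur -lE mem_last.
    rewrite inE; apply/orP; left; apply/imsetP; exists u; first by rewrite !inE ur.
    congr pair; rewrite /par -/s; move: us lus; case/splitPr: vs => s1 s2.
    rewrite -cat_rcons => /andP[]; rewrite cat_path => /andP[p1 _].
    rewrite -cat_cons cat_uniq => /and3P[u1 _ _] _.
    have -> : rcons s1 v = [:: v]; last by [].
    by apply: (upath_unique tH _ us1); rewrite /upath ?p1 //= last_rcons.
  rewrite inE; apply/orP; right; apply/imsetP; exists v.
    rewrite !inE vH andbT; apply: contraNneq vs => vr.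
    rewrite vr; case: (s) lus => [/= ur|a t <-]; last by rewrite /= mem_last.
    by have := padj_neq sH uv; rewrite vr ur eqxx.
  congr pair; have vuP : upath H v (u :: s).
    case/andP: us => ps us.
    by rewrite /upath /= vu ps inE negb_or eq_sym (padj_neq sH uv) vs.
  have [tP lP] := tpathP (cH _ _ vH rH).
  by rewrite /par (upath_unique tH tP vuP) //= lP lus.
have cAB (A' : {set G * G}) f :
    A' = [set f v | v in verts H :\ r] -> #|A'| <= #|verts H|.-1.
  by move=> ->; rewrite (leq_trans (leq_imset_card _ _)) // [#|verts H|](cardsD1 r) rH.
have := leq_trans (subset_leq_card sub) (leq_card_setU _ _).
have vpos : 0 < #|verts H| by apply/card_gt0P; exists r.
have := cAB A _ erefl; have := cAB B _ erefl; lia.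
Qed.

Lemma pdeg_gt0 H x y : stree H -> x \in verts H -> y \in verts H -> x != y ->
  0 < pdeg H x.
Proof.
move=> [_ [_ cH] _] xH yH; have /connectP[[|a s] /=] := cH _ _ xH yH.
  by move=> _ ->; rewrite eqxx.
by case/andP=> xa _ _ _; apply/card_gt0P; exists a; rewrite inE.
Qed.

Lemma sum_pdeg H : \sum_x pdeg H x = #|H.2|.
Proof.
rewrite (eq_bigr (fun x => \sum_y (if (x, y) \in H.2 then 1 else 0))).
  rewrite pair_bigA -sum1_card [RHS]big_mkcond /=.
  by apply: eq_bigr => -[].
move=> x _; rewrite /pdeg -sum1_card big_mkcond /=.
by apply: eq_bigr => y _; rewrite inE.
Qed.

(** Otherwise all vertices but one have degree at least 2, and the degree sum
exceeds twice the number of edges. *)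
Lemma stree_two_leaves H : stree H -> 1 < #|verts H| -> 1 < #|leaves H|.
Proof.
move=> tH V2; rewrite ltnNge; apply/negP => L1.
have deg x : x \in verts H -> 2 <= pdeg H x + (x \in leaves H).
  move=> xH; have [y yH xy] : exists2 y, y \in verts H & x != y.
    have /card_gt0P[y] : 0 < #|verts H :\ x| by move: V2; rewrite (cardsD1 x) xH.
    by rewrite !inE eq_sym => /andP[? ?]; exists y.
  have := pdeg_gt0 tH xH yH xy; rewrite in_leaves xH /=.
  by case: (pdeg H x) => [|[|n]].
have : \sum_(x in verts H) 2 <= \sum_(x in verts H) (pdeg H x + (x \in leaves H)).
  exact: leq_sum.
rewrite sum_nat_const big_split /=.
have : \sum_(x in verts H) pdeg H x <= #|H.2|.
  by rewrite -sum_pdeg big_mkcond /= leq_sum // => x _; case: ifP.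
have : \sum_(x in verts H) (x \in leaves H) <= #|leaves H|.
  rewrite -sum1_card big_mkcond [leqRHS]big_mkcond /=; apply: leq_sum => x _.
  by case: ifP => // _; case: ifP.
have := tree_darts tH; lia.
Qed.

(** For k = 1 this uses the convention that a single vertex is a cycle: it is
the only tree with at most one leaf. *)
Lemma stree_le_t_ended k H : 0 < k -> stree H -> #|leaves H| <= k ->
  #|verts H| <= t_ended G k.
Proof.
move=> k0 tH Lk; apply: leq_bigmax_cond; apply/asboolP.
split; first exact: stree_subgraph.
rewrite /ended_tree; case: eqP => [k1|_]; last by split=> //; apply: stree_tree.
left; have [_ [V0 _] _] := tH; apply/eqP; rewrite eqn_leq card_gt0 V0 andbT.
by rewrite leqNgt; apply/negP => /(stree_two_leaves tH); rewrite ltnNge -k1 Lk.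
Qed.

Lemma cycle_le_t1 c : 1 < size c -> uniq c -> cycle (@adj G) c ->
  size c <= t_ended G 1.
Proof.
move=> c1 uc cc.
pose H : pregraph G := ([set x in c], [set e : G * G |
  [&& e.1 \in c, e.2 \in c & (e.2 == next c e.1) || (e.1 == next c e.2)]]).
have -> : size c = #|verts H| by rewrite cardsE; symmetry; apply/card_uniqP.
apply: leq_bigmax_cond; apply/asboolP; split; last first.
  by right; exists c; split=> // x y; rewrite /padj inE.
move=> x y; rewrite /padj !inE /= => /and3P[xc yc xy]; split=> //.
  case/orP: xy => /eqP->; first exact: next_cycle.
  by rewrite adj_sym; apply: next_cycle.
by rewrite xc yc orbC.
Qed.

(** * Largest trees with adjacent leaves *)

(** The edge xy closes the path of the tree from x to y to a cycle.  If a
vertex b of this path has degree at least 3, exchanging an edge of the path at b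
for xy destroys the leaves x and y and creates at most one new leaf.  Otherwise
the path is the whole tree: it has only two leaves, which settles k > 1, and for
k = 1 the cycle through all its vertices is a 1-ended tree. *)
Lemma adjacent_leaves k H x y : 0 < k -> stree H -> #|leaves H| <= k.+1 ->
  x \in leaves H -> y \in leaves H -> adj x y -> #|verts H| <= t_ended G k.
Proof.
move=> k0 tH Lk xL yL axy; have [sH [_ cH] bH] := tH.
have nxy : x != y by apply: contraTneq axy => ->; rewrite adj_irr.
have xH : x \in verts H by move: xL; rewrite in_leaves => /andP[].
have yH : y \in verts H by move: yL; rewrite in_leaves => /andP[].
have /connectP[s0 ps0 ls0] := cH _ _ xH yH.
case/shortenP: ps0 ls0 => s ps us _ ls {s0}.
have [/hasP[b bs b3]|/hasPn deg2] := boolP (has (fun b => 2 < pdeg H b) s).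
  case/splitPr: bs ps us ls => s1 s2; rewrite cat_path => /andP[ps1 /andP[b'b ps2]].
  set b' := last x s1 in b'b; rewrite -cat_cons cat_uniq last_cat /=.
  case/and3P=> us1 /norP[bs1 us12] /andP[bs2 us2] ls.
  have cx : connect (padj (del_edge H b' b)) b' x.
    rewrite connect_padj_sym; last exact: subgraph_del_edge.
    apply/connectP; exists s1 => //; rewrite del_edgeC.
    exact: path_avoid_edge.
  have cy : connect (padj (del_edge H b' b)) b y.
    apply/connectP; exists s2 => //; apply: path_avoid_edge => //.
    rewrite inE negb_or (padj_neq sH b'b) /=.
    by apply: contra us12 => b's2; apply/hasP; exists b' => //; apply: mem_last.
  have tE := stree_exchange tH b'b axy cx cy.
  rewrite -(verts_exchange sH b'b cx cy); apply: stree_le_t_ended => //.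
  set E := add_edge _ _ _ in tE *.
  suff sub : leaves E \subset b' |: (leaves H :\ x :\ y).
    apply: leq_trans (subset_leq_card sub) _; rewrite cardsU1.
    move: Lk; rewrite (cardsD1 x) xL (cardsD1 y (leaves H :\ x)) in_setD1 yL eq_sym nxy.
    rewrite /= !add1n !ltnS; apply: leq_trans.
    by rewrite -add1n leq_add2r leq_b1.
  apply/subsetP=> z; rewrite in_leaves (verts_exchange sH b'b cx cy).
  case/andP=> zH /eqP z1; rewrite !inE zH; have := pdeg_exchange z tH b'b nxy cx cy.
  rewrite z1 -/b'.
  have [//|zb'] := eqVneq z b'; rewrite //=.
  have [->|zb] := eqVneq z b.
    by case: (pdeg H b) b3 (b == x) (b == y) => [|[|[|n]]] // _ [] [].
  have [->|zx] := eqVneq z x; first by rewrite leaf_pdeg.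
  have [->|zy] := eqVneq z y; first by rewrite leaf_pdeg.
  by rewrite !addn0 => <-.
(* No vertex of the path branches, so the path is a union of components. *)
have clo z w : z \in x :: s -> padj H z w -> w \in x :: s.
  rewrite inE => /predU1P[->{z}|zs].
    case: (s) ps ls => [_ yx|a s' /= /andP[xa _] _]; first by rewrite yx eqxx in nxy.
    by move/(leaf_neighbor (leaf_pdeg xL) xa) <-; rewrite !inE eqxx orbT.
  case/splitPr: zs ps us ls deg2 => s1 s2; rewrite cat_path => /andP[ps1 /andP[az ps2]].
  set a := last x s1 in az => us ls deg2 zw.
  have aM : a \in x :: s1 ++ z :: s2 by rewrite -cat_cons mem_cat mem_last.
  have za : padj H z a by rewrite padj_sym.
  case: s2 ps2 us ls deg2 aM => [_ _|z' s2 /andP[zz' _] us _ deg2 aM].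
    rewrite last_cat /= => zE _ aM.
    by rewrite zE in yL; rewrite -(leaf_neighbor (leaf_pdeg yL) za zw).
  have [<-//|aw] := eqVneq a w.
  have [<-|z'w] := eqVneq z' w; first by rewrite inE mem_cat !inE eqxx !orbT.
  have az' : a != z'.
    apply: contraTneq us => az'; rewrite -cat_cons cat_uniq /= -az'.
    by rewrite mem_last orbT andbF.
  have /deg2 : z \in s1 ++ [:: z, z' & s2] by rewrite mem_cat inE eqxx orbT.
  by rewrite (pdeg_gt2 za zz' zw).
have VE : verts H =i x :: s.
  move=> z; apply/idP/idP => [zH|].
    have /connectP[t pt ->] := cH _ _ xH zH.
    have: x \in x :: s by rewrite inE eqxx.
    move: (x :: s) clo => c cl; elim: t x pt {xL xH axy nxy zH ps us ls} => //=.
    by move=> a t IH b /andP[ba pt] bs; exact: IH pt (cl _ _ bs ba).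
  rewrite inE => /predU1P[->//|zs].
  case/splitPr: zs ps {us ls deg2 clo} => s1 s2; rewrite cat_path /=.
  by case/and3P=> _ /sH[].
have -> : #|verts H| = size (x :: s) by rewrite (eq_card VE); apply/card_uniqP.
have s0 : 0 < size s by case: (s) ls => //= yx; rewrite yx eqxx in nxy.
have [k1|k1] := eqVneq k 1.
  subst k; apply: cycle_le_t1 => //=; rewrite rcons_path -ls adj_sym axy andbT.
  by apply: sub_path ps => a b /sH[].
have -> : size (x :: s) = #|verts H| by rewrite (eq_card VE); symmetry; apply/card_uniqP.
apply: stree_le_t_ended => //; apply: (@leq_trans 2); last first.
  by rewrite ltn_neqAle eq_sym k1.
rewrite (_ : 2 = #|[set x; y]|); last by rewrite cards2 nxy.
apply/subset_leq_card/subsetP=> z; rewrite in_leaves VE !inE.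
case/andP=> /predU1P[->|zs] /eqP z1; first by rewrite eqxx.
case/splitPr: zs ps us ls {clo VE s0 deg2} => s1 s2.
rewrite cat_path => /andP[ps1 /andP[az ps2]].
case: s2 ps2 => [_ _|z' s2 /andP[zz' _]].
  by rewrite last_cat /= => ->; rewrite eqxx orbT.
rewrite -cat_cons cat_uniq /= => /and3P[_ /norP[_ /norP[nz' _]] _] _.
rewrite padj_sym // in az; have := leaf_neighbor z1 az zz' => lE.
by move: nz'; rewrite -lE mem_last.
Qed.

(** * Walks through vertices of degree two *)

(** Paths as functions on indices, so that two paths can be compared at shifted
or reversed indices. *)
Definition walk H (f : nat -> G) n :=
  (forall i, i < n -> padj H (f i) (f i.+1)) /\
  (forall i j, i <= n -> j <= n -> f i = f j -> i = j).

Lemma walk_turn H f n i z : is_subgraph H -> walk H f n -> i.+1 < n ->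
  pdeg H (f i.+1) = 2 -> padj H (f i.+1) z -> z != f i -> z = f i.+2.
Proof.
move=> sH [fp fi] lt d2 az zn.
have a0 : padj H (f i.+1) (f i) by rewrite padj_sym // fp // ltnW.
have a2 : padj H (f i.+1) (f i.+2) by rewrite fp.
apply: (pdeg2_neighbor d2 a0 az a2); first by rewrite eq_sym.
by apply/eqP => /fi; lia.
Qed.

Lemma walk_interior H f n i : is_subgraph H -> walk H f n -> 0 < i -> i < n ->
  1 < pdeg H (f i).
Proof.
move=> sH [fp fi]; case: i => // i _ lt.
have a0 : padj H (f i.+1) (f i) by rewrite padj_sym // fp // ltnW.
apply: (pdeg_gt1 a0 (fp _ lt)).
by apply/eqP => /fi; lia.
Qed.

(** A path can be followed backwards in only one way through vertices of
degree 2, so if two paths share an edge in the same direction, the one with the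
shorter way up to that edge starts on the other. *)
Lemma walks_same_direction H f n g m a b : is_subgraph H ->
  walk H f n -> walk H g m -> a < n -> b < m -> a <= b ->
  f a = g b -> f a.+1 = g b.+1 ->
  (forall j, 0 < j -> j <= a -> pdeg H (f j) = 2) ->
  f 0 = g (b - a) /\ f 1 = g (b - a).+1.
Proof.
move=> sH fw gw; elim: a b => [|a IH] b an bm ab fg fg1 d2.
  by rewrite subn0.
case: b => [//|b] in bm ab fg fg1 *.
rewrite subSS; apply: IH => //; try lia; last by move=> j j0 ja; apply: d2 => //; lia.
have [fp fi] := fw; have [gp gi] := gw.
have p1 : padj H (f a.+1) (f a.+2) by apply: fp.
have p2 : padj H (f a.+1) (f a) by rewrite padj_sym // fp // ltnW.
have p3 : padj H (f a.+1) (g b) by rewrite fg padj_sym // gp // ltnW.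
apply: (pdeg2_neighbor (d2 a.+1 isT (leqnn _)) p1 p2 p3).
  by apply/eqP => /fi; lia.
by rewrite fg1; apply/eqP => /gi; lia.
Qed.

(** If f meets an edge of g in the opposite direction, it must go on along g
backwards, through vertices of degree 2, to the start of g; it cannot stop on
the way because it ends at a leaf. *)
Lemma walks_opposite_direction H f n g m a b : is_subgraph H ->
  walk H f n -> walk H g m -> a < n -> b < m ->
  f a = g b.+1 -> f a.+1 = g b ->
  (forall j, 0 < j -> j <= b -> pdeg H (g j) = 2) -> pdeg H (f n) = 1 ->
  a.+1 + b <= n /\ f (a.+1 + b) = g 0.
Proof.
move=> sH fw gw; elim: b a => [|b IH] a an bm fg fg1 d2 fn.
  by rewrite addn0.
have dg : pdeg H (g b.+1) = 2 by apply: d2.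
have lt : a.+1 < n.
  by rewrite ltn_neqAle an andbT; apply/eqP => aE; move: dg; rewrite -fg1 aE fn.
have [gp gi] := gw.
rewrite -addSnnS; apply: IH => //; try lia; last by move=> j j0 jb; apply: d2 => //; lia.
symmetry; apply: (walk_turn sH fw lt); rewrite ?fg1 //.
  by rewrite padj_sym // gp // ltnW.
by rewrite fg; apply/eqP => /gi; lia.
Qed.

Lemma upath_walk H x s : upath H x s -> walk H (nth x (x :: s)) (size s).
Proof.
move=> /andP[/(pathP x) ps us]; split=> [i|i j il jl /eqP].
  exact: ps.
by rewrite nth_uniq // => /eqP.
Qed.

Lemma last_take (T : eqType) (x : T) (t : seq T) i :
  i <= size t -> last x (take i t) = nth x (x :: t) i.
Proof.
elim: t x i => [|a t IH] x [|i] //= it.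
by rewrite IH //; apply: set_nth_default.
Qed.

(** * Windows in an optimal tree *)
Section Gap.
Variables k lam : nat.
Hypothesis k_gt0 : 0 < k.
Hypothesis gap : t_ended G k + lam <= t_ended G k.+1.

Lemma few_leaves_small H : stree H -> #|leaves H| <= k ->
  #|verts H| + lam <= t_ended G k.+1.
Proof.
move=> tH Lk; apply: leq_trans gap; rewrite leq_add2r.
exact: stree_le_t_ended.
Qed.

Lemma adjacent_leaves_small H x y : stree H -> #|leaves H| <= k.+1 ->
  x \in leaves H -> y \in leaves H -> adj x y ->
  #|verts H| + lam <= t_ended G k.+1.
Proof.
move=> tH Lk xL yL axy; apply: leq_trans gap; rewrite leq_add2r.
exact: (adjacent_leaves k_gt0 tH Lk xL yL).
Qed.

(** Deleting the vertices of the path one by one from y keeps a tree that is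
larger than t_k by the bound on the length, so no branching vertex and no leaf
adjacent to the current end can be met: either would give a k-ended tree of the
current order. *)
Lemma leaf_window s H y : stree H -> #|leaves H| <= k.+1 -> y \in leaves H ->
  upath H y s -> size s + t_ended G k.+1 < #|verts H| + lam ->
  pdeg H (last y s) = (if s is [::] then 1 else 2) /\
  {in leaves H, forall x, x != y -> ~~ adj x (last y s)}.
Proof.
elim: s H y => [|y1 s IH] H y tH Lk yL /=.
  move=> _ big; split; first exact: leaf_pdeg.
  move=> x xL _; apply/negP => axy.
  by have := adjacent_leaves_small tH Lk xL yL axy; rewrite leqNgt big.
rewrite /upath /= => /andP[/andP[yy1 ps] /andP[ys us]].
have sH := stree_subgraph tH; have y1y : padj H y1 y by rewrite padj_sym.
have y1n : y1 != y by rewrite eq_sym (padj_neq sH).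
have tH' := stree_del_leaf tH yL; set H' := del_vertex H y in tH'.
have yH : y \in verts H by move: yL; rewrite in_leaves => /andP[].
have VH : #|verts H| = #|verts H'|.+1 by rewrite (cardsD1 y) yH.
rewrite VH addSn addSn ltnS => big.
have degE z : z != y -> z != y1 -> pdeg H z = pdeg H' z.
  move=> zy zy1; rewrite (pdeg_del_vertex H zy) [padj H z y](_ : _ = false) ?addn0 //.
  apply/negP => zy'; case/eqP: zy1; apply: (leaf_neighbor (leaf_pdeg yL)) => //.
  by rewrite padj_sym.
have degy1 : pdeg H y1 = (pdeg H' y1).+1.
  by rewrite (pdeg_del_vertex H y1n) y1y addn1.
have Ly : #|leaves H :\ y| <= k by move: Lk; rewrite (cardsD1 y) yL.
have LH' z : z \in leaves H' -> z != y1 -> z \in leaves H :\ y.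
  rewrite in_setD1 !in_leaves in_setD1 => /andP[/andP[zy zH] z1] zy1.
  by rewrite zy zH degE.
(* If the new end were not a leaf, the pruned tree would have too few leaves. *)
have y1L' : y1 \in leaves H'.
  apply: contraLR big => y1L; rewrite -leqNgt.
  apply: leq_trans (leq_addl _ _); apply: few_leaves_small => //.
  apply: leq_trans Ly; apply/subset_leq_card/subsetP=> z zL.
  by apply: LH' => //; apply: contraNneq y1L => <-.
have y12 : pdeg H y1 = 2 by rewrite degy1 (leaf_pdeg y1L').
have L'k : #|leaves H'| <= k.+1.
  rewrite (cardsD1 y1) y1L' ltnS; apply: leq_trans Ly.
  apply/subset_leq_card/subsetP=> z; rewrite in_setD1 => /andP[zy1 zL].
  exact: LH'.
have us' : upath H' y1 s.
  apply/andP; split; last exact: us.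
  move: ps ys {us big IH}.
  elim: s (y1) => //= a s IH b /andP[ba ps]; rewrite !inE !negb_or.
  case/and3P=> yb ya ys; rewrite padj_del_vertex ba ![_ == y]eq_sym yb ya /=.
  by apply: IH => //; rewrite inE negb_or ya.
have [degl indl] := IH H' y1 tH' L'k y1L' us' big.
split.
  case: (s) degl us ys => [//|a t] /= degl /andP[y1at _]; rewrite !inE !negb_or.
  case/and3P=> _ ya yt; rewrite degE //.
    by apply/eqP => lE; move: yt ya; have := mem_last a t; rewrite lE inE => /orP[->|->].
  by apply: contraNneq y1at => <-; apply: mem_last.
move=> x xL xy; have xy1 : x != y1.
  by apply/eqP => xE; move: (leaf_pdeg xL); rewrite xE y12.
apply: indl => //; move: xL; rewrite !in_leaves in_setD1 xy => /andP[-> /eqP <-].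
by rewrite degE // eqxx.
Qed.

Definition optimal H :=
  [/\ stree H, #|leaves H| <= k.+1 & #|verts H| = t_ended G k.+1].

Hypothesis lam_gt0 : 0 < lam.

Lemma optimal_leaves H : optimal H -> #|leaves H| = k.+1.
Proof.
case=> tH Lk VH; apply/eqP; rewrite eqn_leq Lk ltnNge; apply/negP.
by move/(few_leaves_small tH); rewrite VH -[leqRHS]addn0 leq_add2l leqNgt lam_gt0.
Qed.

(** A neighbour outside the tree could be attached at h, giving a larger tree
with no more leaves. *)
Lemma leaf_closed H h v : optimal H -> h \in leaves H -> adj h v -> v \in verts H.
Proof.
move=> [tH Lk VH] hL hv; apply: contraT => vH; have sH := stree_subgraph tH.
have hH : h \in verts H by move: hL; rewrite in_leaves => /andP[].
have tE := stree_add_leaf tH hH vH hv.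
have nhv : h != v by apply: contraTneq hv => ->; rewrite adj_irr.
have nph : ~~ padj H h v by apply: contra vH => /sH[].
have VE : verts (add_edge H h v) = v |: verts H.
  by rewrite /add_edge /verts /= setUCA; congr (_ |: _); apply/setUidPr; rewrite sub1set.
suff LE : #|leaves (add_edge H h v)| <= k.+1.
  have := stree_le_t_ended (ltn0Sn k) tE LE.
  by rewrite VE cardsU1 vH VH add1n ltnn.
apply: leq_trans Lk; rewrite (cardsD1 v) [leqRHS](cardsD1 h) hL.
rewrite leq_add ?leq_b1 //; apply/subset_leq_card/subsetP=> z.
rewrite !in_setD1 !in_leaves VE in_setU1 pdeg_add_edge // => /and3P[zv].
rewrite (negPf zv) /= => -> z1.
have [zh|zh] := eqVneq z h; last first.
  by move: z1; rewrite (negPf zh) addn0 => ->.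
by move: z1; rewrite zh eqxx leaf_pdeg.
Qed.

(** Exchanging vw for vh yields an optimal tree in which w has taken the place
of the leaf h; the rest s of the path is then a path starting at a leaf, to
which [leaf_window] applies. *)
Lemma chord_window H h v w s : optimal H -> h \in leaves H -> adj h v ->
  upath H v (w :: s) -> connect (padj (del_edge H w v)) w h ->
  h \notin w :: s -> size s < lam ->
  pdeg H (last w s) = 2 /\ {in leaves H, forall x, x != h -> ~~ adj x (last w s)}.
Proof.
move=> [tH Lk VH] hL hv /andP[/andP[vw ps] /andP[vs us]] cwh hs slam.
have sH := stree_subgraph tH; have wv : padj H w v by rewrite padj_sym.
have nhv : h != v by apply: contraTneq hv => ->; rewrite adj_irr.
have tE := stree_exchange tH wv hv cwh (connect0 _ _).
have VE := verts_exchange sH wv cwh (connect0 _ v).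
have dE z := pdeg_exchange z tH wv nhv cwh (connect0 _ v).
set E := add_edge _ _ _ in tE VE dE.
have nwh : w != h by apply: contraNneq hs => ->; rewrite inE eqxx.
have nwv : w != v := padj_neq sH wv.
have degE z : z != w -> z != h -> pdeg E z = pdeg H z.
  by move=> zw zh; have := dE z; rewrite (negPf zw) (negPf zh) => /addIn.
have degw : pdeg H w = (pdeg E w).+1.
  by have := dE w; rewrite (negPf nwh) (negPf nwv) eqxx addn0 addn1.
have degh : pdeg E h = 2.
  have := dE h; rewrite [h == w]eq_sym (negPf nwh) (negPf nhv) eqxx addn0 addn1.
  by rewrite (leaf_pdeg hL).
have Lh : #|leaves H :\ h| <= k by move: Lk; rewrite (cardsD1 h) hL.
have LE z : z \in leaves E -> z != w -> z \in leaves H :\ h.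
  rewrite in_setD1 !in_leaves VE => /andP[zH /eqP z1] zw.
  have zh : z != h by apply: contra_eqN z1 => /eqP->; rewrite degh.
  by rewrite degE // in z1; rewrite zh zH z1.
(* Otherwise the exchange destroys the leaf h without creating a new one. *)
have wL : w \in leaves E.
  apply: contraT => wL; have : #|leaves E| <= k.
    apply: leq_trans Lh; apply/subset_leq_card/subsetP=> z zL.
    by apply: LE => //; apply: contraNneq wL => <-.
  by move/(few_leaves_small tE); rewrite VE VH -[leqRHS]addn0 leq_add2l leqNgt lam_gt0.
have LEk : #|leaves E| <= k.+1.
  rewrite (cardsD1 w) wL ltnS; apply: leq_trans Lh.
  apply/subset_leq_card/subsetP=> z; rewrite in_setD1 => /andP[zw zL].
  exact: LE.
have uE : upath E w s.
  apply/andP; split; last exact: us.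
  have := path_avoid_edge w ps vs; rewrite del_edgeC.
  by apply: sub_path => a b ab; rewrite padj_add_edge ab.
have big : size s + t_ended G k.+1 < #|verts E| + lam.
  by rewrite VE VH addnC ltn_add2l.
have [degl indl] := leaf_window tE LEk wL uE big.
split.
  case: (s) degl us hs => [_ _ _|a t] /=; first by rewrite degw (leaf_pdeg wL).
  move=> <- /andP[wat _] hs; rewrite degE //.
    by apply: contraNneq wat => <-; apply: mem_last.
  by apply: contraNneq hs => <-; rewrite inE mem_last orbT.
move=> x xL xh; have xw : x != w.
  by apply/eqP => xE; move: (leaf_pdeg xL); rewrite xE degw (leaf_pdeg wL).
apply: indl => //; move: xL; rewrite !in_leaves VE => /andP[-> /eqP <-].
by rewrite degE // eqxx.
Qed.
(** * Charging neighbours of leaves to edges *)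
Section Count.
Variables (H : pregraph G) (X : {set G}) (r : G).
Hypothesis optH : optimal H.
Hypothesis XL : X \subset leaves H.
Hypothesis Xlam : #|X| <= lam.+1.
Hypothesis rX : r \in X.

Let tH : stree H. Proof. by case: optH. Qed.
Let sH : is_subgraph H. Proof. by case: tH. Qed.
Let leafX h : h \in X -> h \in leaves H. Proof. exact: (subsetP XL). Qed.
Let rL : r \in leaves H. Proof. exact: leafX. Qed.

Lemma leaf_vert h : h \in leaves H -> h \in verts H.
Proof. by rewrite in_leaves => /andP[]. Qed.

Definition tree_walk x y : nat -> G := nth x (x :: tpath H x y).
Definition tree_dist x y := size (tpath H x y).

Lemma tree_walk0 x y : tree_walk x y 0 = x. Proof. by []. Qed.

Lemma tree_tpathP x y : x \in verts H -> y \in verts H ->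
  upath H x (tpath H x y) /\ last x (tpath H x y) = y.
Proof. by move=> xH yH; apply: tpathP; case: tH => _ [_ cH] _; apply: cH. Qed.

Lemma tree_walkP x y : x \in verts H -> y \in verts H ->
  walk H (tree_walk x y) (tree_dist x y).
Proof. by move=> xH yH; have [/upath_walk] := tree_tpathP xH yH. Qed.

Lemma tree_walk_end x y : x \in verts H -> y \in verts H ->
  tree_walk x y (tree_dist x y) = y.
Proof.
move=> xH yH; have [_ lE] := tree_tpathP xH yH; rewrite -[RHS]lE.
exact: (nth_last x (x :: _)).
Qed.

Lemma tree_dist_gt0 x y : x \in verts H -> y \in verts H -> x != y ->
  0 < tree_dist x y.
Proof.
move=> xH yH xy; rewrite lt0n; apply: contraNneq xy => l0.
by rewrite -(tree_walk_end xH yH) l0.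
Qed.

Lemma tree_dist_suffix x y z i : x \in verts H -> y \in verts H -> z \in verts H ->
  i <= tree_dist x y -> tree_walk x y i = z -> tree_dist z y = tree_dist x y - i.
Proof.
move=> xH yH zH il iz; have [/andP[ps us] ls] := tree_tpathP xH yH.
have [tz lz] := tree_tpathP zH yH.
have lastt : last x (take i (tpath H x y)) = z.
  by rewrite last_take.
rewrite /tree_dist -size_drop; congr size; apply: (upath_unique tH tz).
  move: ps us; rewrite -{1 2}(cat_take_drop i (tpath H x y)) cat_path lastt.
  move=> /andP[_ pd]; rewrite -cat_cons lastI lastt cat_rcons cat_uniq.
  by case/and3P=> _ _ ud; rewrite /upath pd.
by rewrite lz; move: ls; rewrite -{1}(cat_take_drop i (tpath H x y)) last_cat lastt.
Qed.

Lemma charge_window h v j : h \in leaves H -> adj h v ->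
  0 < j -> j <= lam -> j < tree_dist v h ->
  pdeg H (tree_walk v h j) = 2 /\
  {in leaves H, forall x, x != h -> ~~ adj x (tree_walk v h j)}.
Proof.
move=> hL hv j0 jlam jn; have vH := leaf_closed optH hL hv.
have [fp fi] := tree_walkP vH (leaf_vert hL); have fl := tree_walk_end vH (leaf_vert hL).
have [us ls] := tree_tpathP vH (leaf_vert hL).
rewrite /tree_walk /tree_dist in fp fi fl jn *.
case: (tpath H v h) us ls fp fi fl jn => // w s us ls fp fi fl jn.
case: j => // j in j0 jlam jn *.
have js : j < size s by [].
have -> : nth v (v :: w :: s) j.+1 = last w (take j s).
  by rewrite last_take ?(ltnW js) //; apply: set_nth_default; apply: ltnW.
case/andP: (us) => /andP[vw ps] /andP[vs us'].
apply: (chord_window (v := v) (s := take j s) optH hL hv).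
- rewrite /upath /= vw (take_path _ ps) /=; apply/andP; split; last first.
    by rewrite -[_ && _]/(uniq (take j.+1 (w :: s))) take_uniq.
  by apply: contra vs; rewrite !inE => /predU1P[->|/mem_take->]; rewrite ?eqxx ?orbT.
- apply/connectP; exists s => //; rewrite del_edgeC.
  exact: path_avoid_edge.
- apply/negP => hin; have := hin.
  rewrite -[w :: _]/(take j.+1 (w :: s)) => /(nthP v)[i].
  rewrite size_takel; last exact: ltnW.
  move=> ij; rewrite nth_take // => hE.
  have lt : i.+1 < size (w :: s) by apply: leq_ltn_trans ij jn.
  have := fi i.+1 _ (ltnW lt) (leqnn _); rewrite fl => /(_ hE) iE.
  by move: lt; rewrite iE ltnn.
- by rewrite size_takel // ltnW.
Qed.

(** The far end r only directs the walk from y into the tree.  Since r is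
itself a leaf, the walk cannot stop within the window. *)
Lemma reserved_window y j : y \in leaves H -> y != r -> j < lam ->
  [/\ j < tree_dist y r, 0 < j -> pdeg H (tree_walk y r j) = 2 &
      {in leaves H, forall x, x != y -> ~~ adj x (tree_walk y r j)}].
Proof.
move=> yL yr jlam; have [yH rH] := (leaf_vert yL, leaf_vert rL).
have [_ Lk VH] := optH; have [/andP[ps us] ls] := tree_tpathP yH rH.
have win i : i < lam -> i <= tree_dist y r ->
    pdeg H (tree_walk y r i) = (if i is 0 then 1 else 2) /\
    {in leaves H, forall x, x != y -> ~~ adj x (tree_walk y r i)}.
  move=> ilam il; rewrite /tree_walk -last_take //.
  have ui : upath H y (take i (tpath H y r)).
    rewrite /upath take_path //= -[_ && _]/(uniq (take i.+1 (y :: tpath H y r))).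
    exact: take_uniq.
  have big : size (take i (tpath H y r)) + t_ended G k.+1 < #|verts H| + lam.
    by rewrite size_takel // VH addnC ltn_add2l.
  have [] := leaf_window tH Lk yL ui big; case: (i) il => [|i']; first by rewrite take0.
  by rewrite /tree_dist; case: (tpath H y r).
have jl : j < tree_dist y r.
  rewrite ltnNge; apply/negP => lj; have l0 := tree_dist_gt0 yH rH yr.
  have [] := win _ (leq_ltn_trans lj jlam) (leqnn _).
  by rewrite tree_walk_end // (leaf_pdeg rL); case: (tree_dist y r) l0.
have [d2 nadj] := win j jlam (ltnW jl); split=> //.
by rewrite d2; case: (j).
Qed.

(** The pairs competing for the edge vu; their ranks spread them over
consecutive edges. *)
Definition sharers v u := [set x in X | adj x v && (tree_walk v x 1 == u)].
Definition rank h v := index h (enum (sharers v (tree_walk v h 1))).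

Lemma mem_sharers h v : h \in X -> adj h v -> h \in sharers v (tree_walk v h 1).
Proof. by move=> hX hv; rewrite inE hX hv eqxx. Qed.

Lemma leaves_nonadjacent h g : h \in leaves H -> g \in leaves H -> ~~ adj h g.
Proof.
move=> hL gL; have [_ Lk VH] := optH; apply/negP => hg.
have := adjacent_leaves_small tH Lk hL gL hg.
by rewrite VH -[leqRHS]addn0 leq_add2l leqNgt lam_gt0.
Qed.

Lemma charge_neq h v : adj h v -> v != h.
Proof. by move=> hv; apply: contraTneq hv => ->; rewrite adj_irr. Qed.

Lemma shared_start_lt h g v j : h \in leaves H -> g \in leaves H ->
  adj h v -> adj g v -> h != g -> j < tree_dist v h -> j < tree_dist v g ->
  tree_walk v h j.+1 = tree_walk v g j.+1 -> j.+1 < tree_dist v h.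
Proof.
move=> hL gL hv gv hg jh jg e; have vH := leaf_closed optH hL hv.
rewrite ltn_neqAle jh andbT; apply/eqP => jE.
have hE : tree_walk v g j.+1 = h by rewrite -e jE tree_walk_end // leaf_vert.
have := jg; rewrite leq_eqVlt => /predU1P[gE|lt].
  by case/eqP: hg; rewrite -hE gE tree_walk_end // leaf_vert.
have := walk_interior sH (tree_walkP vH (leaf_vert gL)) (ltn0Sn j) lt.
by rewrite hE (leaf_pdeg hL).
Qed.

(** Two paths that leave v along the same edge towards distinct leaves stay
together throughout the windows, since they meet no branching vertex there and
neither leaf can lie on the path to the other one. *)
Lemma shared_start h g v j : h \in X -> g \in X -> adj h v -> adj g v ->
  h != g -> tree_walk v h 1 = tree_walk v g 1 -> j <= lam ->
  [/\ j < tree_dist v h, j < tree_dist v g, tree_walk v h j = tree_walk v g j &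
      tree_walk v h j.+1 = tree_walk v g j.+1].
Proof.
move=> /leafX hL /leafX gL hv gv hg e1; have vH := leaf_closed optH hL hv.
have [hH gH] := (leaf_vert hL, leaf_vert gL).
elim: j => [_|j IH jlam]; first by split=> //; apply: tree_dist_gt0; rewrite ?charge_neq.
have [jh jg e0 e] := IH (ltnW jlam).
have jh1 := shared_start_lt hL gL hv gv hg jh jg e.
have gh : g != h by rewrite eq_sym.
have jg1 := shared_start_lt gL hL gv hv gh jg jh (esym e).
split=> //; symmetry; have [d2 _] := charge_window hL hv (ltn0Sn j) jlam jh1.
have [gp gi] := tree_walkP vH gH.
apply: (walk_turn sH (tree_walkP vH hH) jh1 d2); first by rewrite e; apply: gp.
by rewrite e0; apply/eqP => /(gi _ _ jg1 (ltnW jg)) /eqP; rewrite gtn_eqF // ltnW.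
Qed.

Lemma rank_lt h v : h \in X -> adj h v -> rank h v < #|sharers v (tree_walk v h 1)|.
Proof. by move=> hX hv; rewrite /rank cardE index_mem mem_enum mem_sharers. Qed.

Lemma card_sharers v u : #|sharers v u| <= #|X|.
Proof. by apply/subset_leq_card/subsetP=> x; rewrite inE => /andP[]. Qed.

Lemma rank_le_lam h v : h \in X -> adj h v -> rank h v <= lam.
Proof.
move=> hX hv; rewrite -ltnS; apply: leq_trans (rank_lt hX hv) _.
exact: leq_trans (card_sharers _ _) Xlam.
Qed.

Lemma rank_gt0 h v : h \in X -> adj h v -> 0 < rank h v ->
  exists g, [/\ g \in X, adj g v, h != g & tree_walk v h 1 = tree_walk v g 1].
Proof.
move=> hX hv r0; have := leq_ltn_trans r0 (rank_lt hX hv).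
rewrite (cardsD1 h) mem_sharers // ltnS => /card_gt0P[g].
rewrite in_setD1 inE => /and4P[gh gX gv /eqP gE].
by exists g; rewrite eq_sym.
Qed.

(** A positive rank means that another leaf shares the start, so that h lies
beyond the window; thus the edge charged for (h, v) exists. *)
Lemma rank_lt_dist h v : h \in X -> adj h v -> rank h v < tree_dist v h.
Proof.
move=> hX hv; have vH := leaf_closed optH (leafX hX) hv.
have hH := leaf_vert (leafX hX).
have [r0|] := posnP (rank h v); first by rewrite r0 tree_dist_gt0 // charge_neq.
move/(rank_gt0 hX hv) => [g [gX gv hg e]].
by have [] := shared_start hX gX hv gv hg e (rank_le_lam hX hv).
Qed.

Lemma charge_window_pdeg h v j : h \in X -> adj h v -> 0 < j -> j <= rank h v ->
  pdeg H (tree_walk v h j) = 2.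
Proof.
move=> hX hv j0 jr; have jlam := leq_trans jr (rank_le_lam hX hv).
by have [] := charge_window (leafX hX) hv j0 jlam (leq_ltn_trans jr (rank_lt_dist hX hv)).
Qed.

(** Following the shared edge backwards shows that v lies on the path from z to
g.  If v <> z, then v is in the window of (g, z), which forces h = g; but the
positive rank of g provides a second leaf with the same window, to which h is
foreign. *)
Lemma charges_same h v g z : h \in X -> adj h v -> g \in X -> adj g z ->
  rank h v <= rank g z -> tree_walk v h (rank h v) = tree_walk z g (rank g z) ->
  tree_walk v h (rank h v).+1 = tree_walk z g (rank g z).+1 -> h = g /\ v = z.
Proof.
move=> hX hv gX gz rr e0 e1.
have vH := leaf_closed optH (leafX hX) hv; have zH := leaf_closed optH (leafX gX) gz.
have [hH gH] := (leaf_vert (leafX hX), leaf_vert (leafX gX)).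
have [v0 v1] := walks_same_direction sH (tree_walkP vH hH) (tree_walkP zH gH)
  (rank_lt_dist hX hv) (rank_lt_dist gX gz) rr e0 e1
  (fun j => charge_window_pdeg (j := j) hX hv).
rewrite tree_walk0 in v0.
have clam : rank g z - rank h v <= lam.
  exact: leq_trans (leq_subr _ _) (rank_le_lam gX gz).
have clen : rank g z - rank h v < tree_dist z g.
  exact: leq_ltn_trans (leq_subr _ _) (rank_lt_dist gX gz).
have [c0|c0] := posnP (rank g z - rank h v).
  rewrite c0 ?tree_walk0 in v0 v1; subst z; split=> //.
  have rE : rank h v = rank g v by apply/eqP; rewrite eqn_leq rr -subn_eq0 c0.
  move: rE; rewrite /rank v1 => rE.
  rewrite -(nth_index h (s := enum (sharers v (tree_walk v g 1))) (x := h)).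
    by rewrite rE nth_index // mem_enum mem_sharers.
  by rewrite mem_enum -v1 mem_sharers.
have [_ nadj] := charge_window (leafX gX) gz c0 clam clen.
have [hg|hg] := eqVneq h g; last by have := nadj _ (leafX hX) hg; rewrite -v0 hv.
subst g; have r0 : 0 < rank h z by apply: leq_trans c0 (leq_subr _ _).
have [x [xX xz hx e]] := rank_gt0 gX gz r0.
have [_ clenx ec _] := shared_start gX xX gz xz hx e clam.
have [_ nadjx] := charge_window (leafX xX) xz c0 clam clenx.
by have := nadjx _ (leafX hX) hx; rewrite -ec -v0 hv.
Qed.

Lemma charge_sharer h v x : h \in X -> adj h v -> x \in sharers v (tree_walk v h 1) ->
  [/\ rank h v < tree_dist v x, tree_walk v x (rank h v) = tree_walk v h (rank h v) &
      tree_walk v x (rank h v).+1 = tree_walk v h (rank h v).+1].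
Proof.
move=> hX hv; rewrite inE => /and3P[xX xv /eqP xE].
have [->|hx] := eqVneq h x; first by split=> //; rewrite rank_lt_dist.
by have [] := shared_start hX xX hv xv hx (esym xE) (rank_le_lam hX hv).
Qed.

(** A leaf sharing the starts of both pairs would have the two starts v and z
behind each other on its paths.  So the sharers of the two starts are disjoint
subsets of X, their number is at most lam + 1, and the path from v to h reaches
z, a neighbour of g <> h, within its window. *)
Lemma charges_opposite h v g z : h \in X -> adj h v -> g \in X -> adj g z ->
  tree_walk v h (rank h v) = tree_walk z g (rank g z).+1 ->
  tree_walk v h (rank h v).+1 = tree_walk z g (rank g z) -> False.
Proof.
move=> hX hv gX gz e0 e1.
have vH := leaf_closed optH (leafX hX) hv; have zH := leaf_closed optH (leafX gX) gz.
have [hH gH] := (leaf_vert (leafX hX), leaf_vert (leafX gX)).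
have dis : [disjoint sharers v (tree_walk v h 1) & sharers z (tree_walk z g 1)].
  rewrite -setI_eq0; apply/eqP/setP=> x; rewrite [RHS]inE in_setI; apply/negP.
  case/andP=> xv xz.
  have [av fa fa1] := charge_sharer hX hv xv; have [bz gb gb1] := charge_sharer gX gz xz.
  have xX : x \in X by move: xv; rewrite inE => /andP[].
  have xH := leaf_vert (leafX xX); have d1 := leaf_pdeg (leafX xX).
  have axv : adj x v by move: xv; rewrite inE => /and3P[].
  have axz : adj x z by move: xz; rewrite inE => /and3P[].
  have [cz ez] : (rank h v).+1 + rank g z <= tree_dist v x /\ 
                 tree_walk v x ((rank h v).+1 + rank g z) = z.
    apply: (walks_opposite_direction sH (tree_walkP vH xH) (tree_walkP zH xH) av bz).
    - by rewrite fa gb1.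
    - by rewrite fa1 gb.
    - move=> j j0 jb; have jlam := leq_trans jb (rank_le_lam gX gz).
      by have [] := charge_window (leafX xX) axz j0 jlam (leq_ltn_trans jb bz).
    - by rewrite tree_walk_end.
  have [cv ev] : (rank g z).+1 + rank h v <= tree_dist z x /\ 
                 tree_walk z x ((rank g z).+1 + rank h v) = v.
    apply: (walks_opposite_direction sH (tree_walkP zH xH) (tree_walkP vH xH) bz av).
    - by rewrite fa1 gb.
    - by rewrite fa gb1.
    - move=> j j0 jb; have jlam := leq_trans jb (rank_le_lam hX hv).
      by have [] := charge_window (leafX xX) axv j0 jlam (leq_ltn_trans jb av).
    - by rewrite tree_walk_end.
  have := tree_dist_suffix vH xH zH cz ez; have := tree_dist_suffix zH xH vH cv ev.
  move: cz cv; move: (tree_dist v x) (tree_dist z x) (rank h v) (rank g z).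
  by clear; move=> *; lia.
have short : (rank h v).+1 + rank g z <= lam.
  rewrite -ltnS addSn -addSn -addnS; apply: leq_trans Xlam.
  apply: leq_trans (leq_add (rank_lt hX hv) (rank_lt gX gz)) _.
  move: dis; rewrite -leq_card_setU => /eqP <-; apply/subset_leq_card.
  by apply/subsetP=> x; rewrite !inE => /orP[]/andP[].
have hg : g != h.
  apply: contraTneq dis => ghE; apply/negP => /disjointFr/(_ (mem_sharers hX hv)).
  by rewrite ghE -ghE mem_sharers.
have [le_n zE] := walks_opposite_direction sH (tree_walkP vH hH) (tree_walkP zH gH)
  (rank_lt_dist hX hv) (rank_lt_dist gX gz) e0 e1
  (fun j => charge_window_pdeg (j := j) gX gz)
  (etrans (congr1 _ (tree_walk_end vH hH)) (leaf_pdeg (leafX hX))).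
rewrite tree_walk0 in zE.
move: le_n; rewrite leq_eqVlt => /predU1P[nE|lt].
  move: zE; rewrite nE tree_walk_end // => hz; move: gz; rewrite -hz.
  by apply/negP/leaves_nonadjacent; apply: leafX.
have [_ nadj] := charge_window (leafX hX) hv (ltn0Sn _) short lt.
by have := nadj _ (leafX gX) hg; rewrite zE gz.
Qed.

Section Reserved.
Variables (y : G) (b : nat).
Hypotheses (yR : y \in leaves H :\: X) (blam : b < lam).

Lemma reserved_leaf : [/\ y \in leaves H, y \notin X & y != r].
Proof.
move: yR; rewrite in_setD => /andP[yX yL]; split=> //.
by apply: contraNneq yX => ->.
Qed.

Lemma reserved_window_pdeg : b < tree_dist y r /\
  (forall j, 0 < j -> j <= b -> pdeg H (tree_walk y r j) = 2).
Proof.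
have [yL _ yr] := reserved_leaf; split; first by have [] := reserved_window yL yr blam.
move=> j j0 jb; have [_ d _] := reserved_window yL yr (leq_ltn_trans jb blam).
exact: d.
Qed.

(** A leaf lies on a path only at its ends, and y, being outside X, is not the
end x. *)
Lemma reserved_end v x c : v \in verts H -> x \in X -> 0 < c -> c <= tree_dist v x ->
  tree_walk v x c <> y.
Proof.
move=> vH xX c0 cl cE; have [yL yX _] := reserved_leaf.
have xH := leaf_vert (leafX xX).
move: cl; rewrite leq_eqVlt => /predU1P[cE'|lt].
  by move: yX; rewrite -cE cE' tree_walk_end // xX.
by have := walk_interior sH (tree_walkP vH xH) c0 lt; rewrite cE leaf_pdeg.
Qed.

Lemma reserved_charge_same h v : h \in X -> adj h v ->
  tree_walk y r b = tree_walk v h (rank h v) ->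
  tree_walk y r b.+1 = tree_walk v h (rank h v).+1 -> False.
Proof.
move=> hX hv e0 e1; have [yL yX yr] := reserved_leaf.
have vH := leaf_closed optH (leafX hX) hv; have hH := leaf_vert (leafX hX).
have [yH rH] := (leaf_vert yL, leaf_vert rL); have [bl d2] := reserved_window_pdeg.
have [le|lt] := leqP (rank h v) b.
  have [v0 _] := walks_same_direction sH (tree_walkP vH hH) (tree_walkP yH rH)
    (rank_lt_dist hX hv) bl le (esym e0) (esym e1)
    (fun j => charge_window_pdeg (j := j) hX hv).
  rewrite tree_walk0 in v0.
  have [_ _ nadj] := reserved_window yL yr (leq_ltn_trans (leq_subr (rank h v) _) blam).
  have hy : h != y by apply: contraNneq yX => <-.
  by have := nadj _ (leafX hX) hy; rewrite -v0 hv.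
have [y0 _] := walks_same_direction sH (tree_walkP yH rH) (tree_walkP vH hH)
  bl (rank_lt_dist hX hv) (ltnW lt) e0 e1 d2.
apply: (reserved_end vH hX _ _ (esym y0)); first by rewrite subn_gt0.
exact: leq_trans (leq_subr _ _) (ltnW (rank_lt_dist hX hv)).
Qed.

Lemma reserved_charge_opposite h v : h \in X -> adj h v ->
  tree_walk v h (rank h v) = tree_walk y r b.+1 ->
  tree_walk v h (rank h v).+1 = tree_walk y r b -> False.
Proof.
move=> hX hv e0 e1; have [yL yX yr] := reserved_leaf.
have vH := leaf_closed optH (leafX hX) hv; have hH := leaf_vert (leafX hX).
have [yH rH] := (leaf_vert yL, leaf_vert rL); have [bl d2] := reserved_window_pdeg.
have [le_n] := walks_opposite_direction sH (tree_walkP vH hH) (tree_walkP yH rH)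
  (rank_lt_dist hX hv) bl e0 e1 d2
  (etrans (congr1 _ (tree_walk_end vH hH)) (leaf_pdeg (leafX hX))).
exact: reserved_end.
Qed.

End Reserved.

Lemma reserved_same y b y' b' : y \in leaves H :\: X -> y' \in leaves H :\: X ->
  b < lam -> b' < lam -> b <= b' -> tree_walk y r b = tree_walk y' r b' ->
  tree_walk y r b.+1 = tree_walk y' r b'.+1 -> y = y' /\ b = b'.
Proof.
move=> yR yR' bl bl' bb e0 e1.
have [[yL _ yr] [yL' _ yr']] := (reserved_leaf yR, reserved_leaf yR').
have [yH yH'] := (leaf_vert yL, leaf_vert yL').
have [[bn d2] [bn' _]] := (reserved_window_pdeg yR bl, reserved_window_pdeg yR' bl').
have [y0 _] := walks_same_direction sH (tree_walkP yH (leaf_vert rL))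
  (tree_walkP yH' (leaf_vert rL)) bn bn' bb e0 e1 d2.
have [c0|c0] := posnP (b' - b).
  split; first by move: y0; rewrite c0.
  by apply/eqP; rewrite eqn_leq bb -subn_eq0 c0.
case: (reserved_end yR yH' rX c0 _ (esym y0)).
exact: leq_trans (leq_subr _ _) (ltnW bn').
Qed.

Lemma reserved_opposite y b y' b' : y \in leaves H :\: X -> y' \in leaves H :\: X ->
  b < lam -> b' < lam -> tree_walk y r b = tree_walk y' r b'.+1 ->
  tree_walk y r b.+1 = tree_walk y' r b' -> False.
Proof.
move=> yR yR' bl bl' e0 e1.
have [[yL _ yr] [yL' _ yr']] := (reserved_leaf yR, reserved_leaf yR').
have [yH yH'] := (leaf_vert yL, leaf_vert yL').
have [[bn _] [bn' d2]] := (reserved_window_pdeg yR bl, reserved_window_pdeg yR' bl').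
have [le_n] := walks_opposite_direction sH (tree_walkP yH (leaf_vert rL))
  (tree_walkP yH' (leaf_vert rL)) bn bn' e0 e1 d2
  (etrans (congr1 _ (tree_walk_end yH (leaf_vert rL))) (leaf_pdeg rL)).
exact: reserved_end.
Qed.
(** The two kinds of claims on edges: a leaf of X with one of its neighbours,
and a leaf outside X with an index below lam. *)
Definition is_charge (i : (G * G) + (G * 'I_lam)) :=
  match i with
  | inl e => (e.1 \in X) && adj e.1 e.2
  | inr e => e.1 \in leaves H :\: X
  end.

Definition charged (i : (G * G) + (G * 'I_lam)) : G * G :=
  match i with
  | inl (h, v) => (tree_walk v h (rank h v), tree_walk v h (rank h v).+1)
  | inr (y, b) => (tree_walk y r b, tree_walk y r b.+1)
  end.

Lemma charged_padj i : is_charge i -> charged i \in H.2.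
Proof.
case: i => [[h v] /= /andP[hX hv]|[y b] /= yR].
  have [fp _] := tree_walkP (leaf_closed optH (leafX hX) hv) (leaf_vert (leafX hX)).
  by apply: fp; apply: rank_lt_dist.
have [yL _ _] := reserved_leaf yR.
have [fp _] := tree_walkP (leaf_vert yL) (leaf_vert rL).
by apply: fp; have [] := reserved_window_pdeg yR (ltn_ord b).
Qed.

Lemma charged_inj : {in is_charge &, injective charged}.
Proof.
move=> [[h v]|[y b]] [[g z]|[y' b']]; rewrite -!topredE /=.
- move=> /andP[hX hv] /andP[gX gz] [e0 e1].
  have [le|/ltnW le] := leqP (rank h v) (rank g z).
    by have [-> ->] := charges_same hX hv gX gz le e0 e1.
  by have [-> ->] := charges_same gX gz hX hv le (esym e0) (esym e1).
- move=> /andP[hX hv] yR [e0 e1].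
  by case: (reserved_charge_same yR (ltn_ord b') hX hv (esym e0) (esym e1)).
- move=> yR /andP[gX gz] [e0 e1].
  by case: (reserved_charge_same yR (ltn_ord b) gX gz e0 e1).
move=> yR yR' [e0 e1]; have [le|/ltnW le] := leqP b b'.
  have [-> bE] := reserved_same yR yR' (ltn_ord b) (ltn_ord b') le e0 e1.
  by congr (inr (_, _)); apply: val_inj.
have [-> bE] := reserved_same yR' yR (ltn_ord b') (ltn_ord b) le (esym e0) (esym e1).
by congr (inr (_, _)); apply: val_inj.
Qed.

Lemma charged_antisym i j : is_charge i -> is_charge j ->
  charged i <> ((charged j).2, (charged j).1).
Proof.
case: i j => [[h v]|[y b]] [[g z]|[y' b']] /=.
- move=> /andP[hX hv] /andP[gX gz] [e0 e1].
  exact: charges_opposite hX hv gX gz e0 e1.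
- move=> /andP[hX hv] yR [e0 e1].
  exact: reserved_charge_opposite yR (ltn_ord b') _ _ hX hv e0 e1.
- move=> yR /andP[gX gz] [e0 e1].
  exact: reserved_charge_opposite yR (ltn_ord b) _ _ gX gz (esym e1) (esym e0).
move=> yR yR' [e0 e1].
exact: reserved_opposite yR yR' (ltn_ord b) (ltn_ord b') e0 e1.
Qed.

Lemma card_charges :
  #|[set i | is_charge i]| = \sum_(h in X) deg h + #|leaves H :\: X| * lam.
Proof.
rewrite -sum1_card (eq_bigl is_charge); last by move=> i; rewrite inE.
rewrite big_sumType /=; congr (_ + _).
  rewrite -(pair_big_dep (fun h => h \in X) (fun h v => adj h v) (fun _ _ => 1)) /=.
  by apply: eq_bigr => h _; rewrite /deg -sum1_card; apply: eq_bigl => v; rewrite inE.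
rewrite -[X in _ * X](card_ord lam) -cardsT -cardsX -sum1_card.
by apply: eq_bigl => -[y b]; rewrite !inE andbT.
Qed.

(** The charged darts and their reversals are twice as many distinct elements
of [H.2] as there are claims. *)
Lemma sum_deg_le :
  \sum_(h in X) deg h + (k.+1 - #|X|) * lam + 1 <= t_ended G k.+1.
Proof.
have := tree_darts tH; have [_ _ VH] := optH; rewrite VH.
have := card_charges; rewrite cardsD (setIidPr XL) (optimal_leaves optH).
set S := [set i | is_charge i] => SE.
pose flip (e : G * G) := (e.2, e.1).
have flip_inj : injective flip by move=> [a b] [c d] [-> ->].
have inS i : (i \in S) = is_charge i by rewrite inE.
have cE : #|charged @: S| = #|S|.
  by apply: card_in_imset => i j; rewrite !inS; apply: charged_inj.
have cF : #|flip @: (charged @: S)| = #|S| by rewrite card_imset.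
have dis : [disjoint charged @: S & flip @: (charged @: S)].
  rewrite -setI_eq0; apply/eqP/setP=> e; rewrite [RHS]inE in_setI; apply/negP.
  case/andP=> /imsetP[i iS ->] /imsetP[_ /imsetP[j jS ->]] ijE.
  rewrite !inS in iS jS; exact: charged_antisym iS jS ijE.
have sub : charged @: S :|: flip @: (charged @: S) \subset H.2.
  apply/subsetP=> e; rewrite in_setU => /orP[/imsetP[i iS ->]|].
    by apply: charged_padj; rewrite -inS.
  case/imsetP=> _ /imsetP[i iS ->] ->; rewrite -[_ \in _]/(padj H _ _).
  rewrite padj_sym // /padj -surjective_pairing.
  by apply: charged_padj; rewrite -inS.
have := subset_leq_card sub; move: dis; rewrite -leq_card_setU => /eqP ->.
rewrite cE cF SE.
move: (\sum_(h in X) deg h) ((k.+1 - #|X|) * lam) #|H.2| (t_ended G k.+1).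
by clear; move=> *; lia.
Qed.

End Count.
End Gap.
End Trees.

(** * The dichotomy *)

Theorem theorem2 (G : sgraph) (k lambda m : nat)
    (connG : connected G)
    (k_gt0 : (0 < k)%N) (lambda_gt0 : (0 < lambda)%N) (m_gt0 : (0 < m)%N)
    (m_ge2 : (2 <= m)%N) (m_le : (m <= minn k lambda + 1)%N) :
  (sigma G m + (lambda%:Z * (k%:Z - m%:Z + 1) + 1)%R%:E
     <= ((t_ended G (k + 1))%:Z)%:E)%E
  \/
  ((t_ended G (k + 1))%:Z - lambda%:Z + 1 <= (t_ended G k)%:Z)%R.
Proof.
rewrite addn1; have [gap|nogap] := leqP (t_ended G k + lambda) (t_ended G k.+1);
  last by right; lia.
left; have [H optH] : exists H : pregraph G, optimal k H.
  have N0 : 0 < t_ended G k.+1.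
    by apply: leq_trans _ gap; rewrite addn_gt0 lambda_gt0 orbT.
  have [H PH NE] : exists2 H : pregraph G, `[< is_subgraph H /\ ended_tree k.+1 H >] &
      t_ended G k.+1 = #|verts H|.
    move: N0; rewrite /t_ended; elim/big_ind: _ => //.
      move=> a b IHa IHb; rewrite /maxn; case: (ltnP a b) => _ ab; first exact: IHb.
      exact: IHa.
    by move=> H PH _; exists H.
  move/asboolP: PH => [sH]; rewrite /ended_tree eqSS eqn0Ngt k_gt0 /= => -[treeH LH].
  by exists H; split=> //; apply: tree_stree.
have Lk := optimal_leaves k_gt0 gap lambda_gt0 optH.
have mk : m <= #|leaves H| by rewrite Lk; lia.
have [X XL Xm] : exists2 X : {set G}, X \subset leaves H & #|X| = m.
  have /card_geqP[s [us sm sL]] := mk; exists [set x in s].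
    by apply/subsetP=> x; rewrite inE => /sL.
  by rewrite cardsE -sm; apply/card_uniqP.
have indX : independent X.
  apply/forall_inP=> x /(subsetP XL) xL; apply/forall_inP=> y /(subsetP XL) yL.
  exact: (leaves_nonadjacent k_gt0 gap lambda_gt0 optH).
have [r rX] : exists r, r \in X by apply/card_gt0P; rewrite Xm.
have Xlam : #|X| <= lambda.+1 by rewrite Xm; lia.
have := sum_deg_le k_gt0 gap lambda_gt0 optH XL Xlam rX; rewrite Xm => bound.
have malpha : m <= alpha G by rewrite -Xm; apply: leq_bigmax_cond.
have sigma_le : (sigma G m <= ((\sum_(x in X) deg x)%N%:Z)%:E)%E.
  by rewrite /sigma malpha; apply: Order.TotalTheory.bigmin_le_cond; rewrite indX Xm eqxx.
apply: Order.POrderTheory.le_trans (leeD2r _ sigma_le) _; rewrite -EFinD lee_fin.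
have -> : (k%:Z - m%:Z + 1 = (k.+1 - m)%:Z)%R by lia.
move: (\sum_(x in X) deg x) (k.+1 - m) bound => d p; rewrite mulnC => bound.
by clear -bound; lia.
Qed.
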